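(* Let $N_*=(N_{k,i})_{k\ge1,\,i\in\{1,2,3\}}$ be any sequence of positive integers and let $\Omega[N_*]$ be the greatest common divisor of all the numbers $N_{k,2}$ and $N_{k,3}$, $k\ge1$. Let $\rho \in\, ]0,1[$. The map $$\varphi\longmapsto\boldsymbol{\nu}^{\Phi}_{\infty}[N_*]\left(\rho,\varphi\right)$$ is $\frac{2\pi}{7\Omega[N_*]}$-periodic.
   Context: Points are given in polar coordinates $(\rho,\varphi)$, $0<\rho<1$, $\varphi\in\mathbb{R}/2\pi\mathbb{Z}$; tangent spaces are identified with $\mathbb{R}^2$ by the direct basis $(\partial_\rho,\partial_\varphi)$. $\wedge$ is the cross product in $\mathbb{E}^3$; $\Psi^*\langle\cdot,\cdot\rangle(v,w)=\langle\Psi v,\Psi w\rangle$. $J_0$ is the Bessel function of the first kind of order 0, $\kappa_0$ its first positive zero, $J_0^{-1}:\,]0,1]\to[0,\kappa_0[$ the inverse of $J_0|_{[0,\kappa_0[}$. Data. $a=\frac{7}{2\pi}$; $\varpi_1=-\rho$, $\varpi_2=\rho-a\varphi$, $\varpi_3=\rho+a\varphi$; $\ell_i=d\varpi_i$; for $B=E\,d\rho^2+F(d\rho\otimes d\varphi+d\varphi\otimes d\rho)+G\,d\varphi^2$, $H_1(B)=E-\frac{G}{a^2}$, $H_2(B)=\frac{G}{2a^2}-\frac{F}{2a}$, $H_3(B)=\frac{G}{2a^2}+\frac{F}{2a}$ (so $B=\sum_iH_i(B)\ell_i\otimes\ell_i$). $f_0(\rho,\varphi)=2(\rho\cos\varphi,\rho\sin\varphi,\frac{\sqrt2}{2}\rho^2)$,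 and $g_k=f_0^*\langle\cdot,\cdot\rangle+4\sum_{n=1}^k(n+2)\rho^{2(n+1)}d\rho^2+4\sum_{n=1}^k(n+1)\rho^{2(n+1)}d\varphi^2$. Frame of $(\Psi,\ell)$. For an injective linear map $\Psi:\mathbb{R}^2\to\mathbb{E}^3$ and a nonzero linear form $\ell$, let $(v,w)$ be a direct basis of $\mathbb{R}^2$ with $\ell(v)>0$, $w\in\ker\ell$; the frame is $(\mathbf t,\mathbf w,\mathbf n)$ with $\mathbf w=\frac{\Psi(w)}{\|\Psi(w)\|}$, $\mathbf n=\frac{\Psi(v)\wedge\Psi(w)}{\|\Psi(v)\wedge\Psi(w)\|}$, $\mathbf t=\mathbf w\wedge\mathbf n$. Formal corrugation process. For $\eta\ge0$ and an integer $N\ge1$, pointwise $FCP(\Phi,\eta,\varpi,N)=\Phi+\big(r(\cos\theta\,\mathbf t+\sin\theta\,\mathbf n)-\Phi(u)\big)\otimes d\varpi$, where $(\mathbf t,\mathbf w,\mathbf n)$ is the frame of $(\Phi,d\varpi)$, $u$ is the vector with $\Phi(u)$ collinear to $\mathbf t$ and $d\varpi(u)=1$, $r=\sqrt{\eta+\|\Phi(u)\|^2}$, $\alpha=J_0^{-1}(\|\Phi(u)\|/r)$, $\theta=\alpha\cos(2\pi N\varpi)$. Formal analogue. $\Phi_{1,0}=df_0$, $\Phi_{k,i}=FCP(\Phi_{k,i-1},\eta_{k,i},\varpi_i,N_{k,i})$ with $\eta_{k,i}=H_i(g_k-\Phi_{k,i-1}^*\langle\cdot,\cdot\rangle)$,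 $i=1,2,3$, $\Phi_{k+1,0}=\Phi_{k,3}$. This sequence is well defined for every $N_*$ and converges on $0<\rho<1$ to a continuous field $\Phi_\infty$ of injective linear maps with $\Phi_\infty^*\langle\cdot,\cdot\rangle=4\frac{d\rho^2+\rho^2d\varphi^2}{(1-\rho^2)^2}$. $\mathbf F_0$ is the frame of $(df_0,\ell_1)$, viewed as an orthogonal matrix field, and $\mathbf n^\Phi_\infty$ is the unit normal of $\Phi_\infty$ (third vector of the frame of $(\Phi_\infty,\ell_1)$). The formal pattern map $\boldsymbol\nu^\Phi_\infty=\boldsymbol\nu^\Phi_\infty[N_*]$ with values in $\mathbb{R}^3$ is defined by $\mathbf n^\Phi_\infty=\mathbf F_0\cdot\boldsymbol\nu^\Phi_\infty$. *)

(* Defs.v *)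
From HB Require Import structures.
From mathcomp Require Import all_boot all_order all_algebra.
From mathcomp Require Import all_classical all_reals all_analysis.

Set Implicit Arguments.
Unset Strict Implicit.
Unset Printing Implicit Defensive.

Import Order.TTheory GRing.Theory Num.Theory.
Import numFieldNormedType.Exports.

Local Open Scope classical_set_scope.
Local Open Scope ring_scope.

(* A point is a pair (rho, phi) of reals: fields over the punctured disc are
   written as functions of rho and of a lift phi of the angle.  Tangent vectors
   are columns 'cV_2 and linear forms rows 'rV_2 in the basis
   (d/drho, d/dphi), linear maps from R^2 to E^3 are 'M_(3, 2) matrices acting
   on the left, and a symmetric bilinear form B on R^2 is its Gram matrix, with
   E = B 0 0, F = B 0 1 and G = B 1 1.

   The data below are total functions.  Objects specified by a property are
   picked with [get]; out of their domain of definition (an [eta] for which the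
   root or the inverse of the Bessel function is meaningless, a non-injective
   [Phi]) they take default values. *)

Section EuclideanSpace.
Variable R : realType.
Implicit Types x y : 'cV[R]_3.

Definition dot x y : R := \sum_i x i 0 * y i 0.

(* `|x| is the sup norm on matrices, hence this Euclidean norm *)
Definition enorm x : R := Num.sqrt (dot x x).

Definition normalize x : 'cV[R]_3 := (enorm x)^-1 *: x.

Definition vec3 (a b c : R) : 'cV[R]_3 := \col_i [:: a; b; c]`_i.

Definition cross x y : 'cV[R]_3 :=
  let x_ i := x (inord i) 0 in let y_ i := y (inord i) 0 in
  vec3 (x_ 1%N * y_ 2%N - x_ 2%N * y_ 1%N)
       (x_ 2%N * y_ 0%N - x_ 0%N * y_ 2%N)
       (x_ 0%N * y_ 1%N - x_ 1%N * y_ 0%N).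

Definition pullback (Psi : 'M[R]_(3, 2)) : 'M[R]_2 := Psi^T *m Psi.

End EuclideanSpace.

Section Bessel.
Variable R : realType.

Definition bessel_J0 (x : R) : R :=
  limn (series (fun m : nat =>
    (- 1) ^+ m / (m`!%:R) ^+ 2 * (x / 2) ^+ m.*2)).

Definition kappa0 : R :=
  get [set x : R | [/\ 0 < x, bessel_J0 x = 0 &
                      forall y, 0 < y < x -> bessel_J0 y != 0]].

Definition bessel_J0_inv (y : R) : R :=
  get [set x : R | 0 <= x < kappa0 /\ bessel_J0 x = y].

End Bessel.

Section Differentials.
Variable R : realType.

Definition dform (f : R -> R -> R) (rho phi : R) : 'rV[R]_2 :=
  \row_j [:: derive1 (fun r => f r phi) rho; derive1 (fun p => f rho p) phi]`_j.

Definition dmap (f : R -> R -> 'cV[R]_3) (rho phi : R) : 'M[R]_(3, 2) :=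
  \matrix_(i, j) dform (fun r p => f r p i 0) rho phi 0 j.

End Differentials.

Section FormalCorrugation.
Variable R : realType.

Definition adapted_basis (l : 'rV[R]_2) (v w : 'cV[R]_2) : Prop :=
  [/\ 0 < \det (row_mx v w : 'M[R]_2), 0 < (l *m v) 0 0 & l *m w = 0].

Record frame := Frame {
  frame_t : 'cV[R]_3; frame_w : 'cV[R]_3; frame_n : 'cV[R]_3 }.

(* For injective [Psi] and nonzero [l], the result does not depend on the
   adapted basis that is picked. *)
Definition frame_of (Psi : 'M[R]_(3, 2)) (l : 'rV[R]_2) : frame :=
  let vw := get [set vw : 'cV[R]_2 * 'cV[R]_2 | adapted_basis l vw.1 vw.2] in
  let w := normalize (Psi *m vw.2) in
  let n := normalize (cross (Psi *m vw.1) (Psi *m vw.2)) in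
  Frame (cross w n) w n.

Definition frame_mx (F : frame) : 'M[R]_3 :=
  row_mx (frame_t F) (row_mx (frame_w F) (frame_n F)).

Definition FCP (Phi : R -> R -> 'M[R]_(3, 2)) (eta varpi : R -> R -> R)
    (N : nat) (rho phi : R) : 'M[R]_(3, 2) :=
  let P := Phi rho phi in
  let l := dform varpi rho phi in
  let F := frame_of P l in
  let t := frame_t F in
  let n := frame_n F in
  let u : 'cV[R]_2 :=
    get [set u : 'cV[R]_2 | (exists c : R, P *m u = c *: t) /\
                            l *m u = 1%:M] in
  let r := Num.sqrt (eta rho phi + enorm (P *m u) ^+ 2) in
  let alpha := bessel_J0_inv (enorm (P *m u) / r) in
  let theta := alpha * cos (2 * pi * N%:R * varpi rho phi) in
  P + (r *: (cos theta *: t + sin theta *: n) - P *m u) *m l.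

End FormalCorrugation.

Variant direction := Dir1 | Dir2 | Dir3.

Section FormalAnalogue.
Variable R : realType.

Definition slope : R := 7 / (2 * pi).

Definition varpi (i : direction) (rho phi : R) : R :=
  match i with
  | Dir1 => - rho
  | Dir2 => rho - slope * phi
  | Dir3 => rho + slope * phi
  end.

Definition Hcoef (i : direction) (B : 'M[R]_2) : R :=
  let E := B 0 0 in let F := B 0 1 in let G := B 1 1 in
  match i with
  | Dir1 => E - G / slope ^+ 2
  | Dir2 => G / (2 * slope ^+ 2) - F / (2 * slope)
  | Dir3 => G / (2 * slope ^+ 2) + F / (2 * slope)
  end.

Definition f0 (rho phi : R) : 'cV[R]_3 :=
  2 *: vec3 (rho * cos phi) (rho * sin phi) (Num.sqrt 2 / 2 * rho ^+ 2).

Definition g (k : nat) (rho phi : R) : 'M[R]_2 :=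
  pullback (dmap f0 rho phi)
  + (4 * \sum_(1 <= n < k.+1) n.+2%:R * rho ^+ (2 * n.+1)) *: delta_mx 0 0
  + (4 * \sum_(1 <= n < k.+1) n.+1%:R * rho ^+ (2 * n.+1)) *: delta_mx 1 1.

Definition corrugate (N : nat -> direction -> nat) (k : nat) (i : direction)
    (Phi : R -> R -> 'M[R]_(3, 2)) : R -> R -> 'M[R]_(3, 2) :=
  FCP Phi (fun rho phi => Hcoef i (g k rho phi - pullback (Phi rho phi)))
      (varpi i) (N k i).

(* [Phi_seq N m] is Phi_{k, i} for m = 3 (k - 1) + i with k >= 1 and
   0 <= i <= 3; the identification Phi_{k+1, 0} = Phi_{k, 3} is built in.
   Only the values [N k i] with k >= 1 are used. *)
Fixpoint Phi_seq (N : nat -> direction -> nat) (m : nat)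
    : R -> R -> 'M[R]_(3, 2) :=
  if m is m'.+1 then
    corrugate N (m' %/ 3).+1 (nth Dir1 [:: Dir1; Dir2; Dir3] (m' %% 3))
      (Phi_seq N m')
  else dmap f0.

Definition Phi_infty (N : nat -> direction -> nat) (rho phi : R)
    : 'M[R]_(3, 2) :=
  limn (fun m => Phi_seq N m rho phi).

Definition F0 (rho phi : R) : 'M[R]_3 :=
  frame_mx (frame_of (dmap f0 rho phi) (dform (varpi Dir1) rho phi)).

Definition normal_infty (N : nat -> direction -> nat) (rho phi : R)
    : 'cV[R]_3 :=
  frame_n (frame_of (Phi_infty N rho phi) (dform (varpi Dir1) rho phi)).

Definition nu_infty (N : nat -> direction -> nat) (rho phi : R) : 'cV[R]_3 :=
  invmx (F0 rho phi) *m normal_infty N rho phi.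

End FormalAnalogue.

Definition common_divisor (N : nat -> direction -> nat) (d : nat) : Prop :=
  forall k, (1 <= k)%N -> (d %| N k Dir2)%N /\ (d %| N k Dir3)%N.

Definition Omega (N : nat -> direction -> nat) : nat :=
  get [set d | common_divisor N d /\
               forall e, common_divisor N e -> (e %| d)%N].

(* Main.v *)
(* For t = 2 pi / (7 Omega), the shift phi |-> phi + t changes N_{k,2} varpi_2
   and N_{k,3} varpi_3 by integers, because slope * t = 1 / Omega, and fixes
   varpi_1.  Hence every ingredient of the corrugation process is equivariant
   under the rotation of angle t about the vertical axis: all the Phi_{k,i},
   their limit, its normal and F_0 are left-multiplied by this rotation, which
   cancels in nu = F_0^{-1} n.  The vectors picked by [get] are equivariant
   because they are picked in the same sets at phi and at phi + t. *)

Require Import Defs.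
From mathcomp Require Import all_boot all_order all_algebra.
From mathcomp Require Import all_classical all_reals all_analysis.
From mathcomp Require Import ring lra.

Set Implicit Arguments.
Unset Strict Implicit.
Unset Printing Implicit Defensive.

Import Order.TTheory GRing.Theory Num.Theory.
Import numFieldNormedType.Exports.

Local Open Scope classical_set_scope.
Local Open Scope ring_scope.

(** * Rotations about the vertical axis and their action on frames and corrugations *)

Section Rotation.
Variable R : realType.
Implicit Types (x y : 'cV[R]_3) (t : R).

Definition rotz t : 'M[R]_3 := \matrix_(i, j)
  (nth [::] [:: [:: cos t; - sin t; 0];
                [:: sin t; cos t; 0];
                [:: 0; 0; 1]] i)`_j.

(** Reduces vector identities to polynomial identities in coordinates, within reach of [ring]. *)
Lemma vec3_ex x : exists a b c, x = vec3 a b c.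
Proof.
exists (x 0 0), (x 1 0), (x 2 0); apply/colP; case=> -[|[|[|]]] // lt_i3;
  by rewrite !mxE /=; congr (x _ _); apply/val_inj.
Qed.

Lemma dot_vec3 (a b c a' b' c' : R) :
  dot (vec3 a b c) (vec3 a' b' c') = a * a' + b * b' + c * c'.
Proof. by rewrite /dot !big_ord_recl big_ord0 !mxE /= addr0 addrA. Qed.

Lemma cross_vec3 (a b c a' b' c' : R) :
  cross (vec3 a b c) (vec3 a' b' c') =
  vec3 (b * c' - c * b') (c * a' - a * c') (a * b' - b * a').
Proof. by rewrite /cross !mxE !inordK. Qed.

Lemma scale_vec3 (k a b c : R) : k *: vec3 a b c = vec3 (k * a) (k * b) (k * c).
Proof. by apply/colP; case=> -[|[|[|]]] // ?; rewrite !mxE. Qed.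

Lemma rotz_vec3 t (a b c : R) : rotz t *m vec3 a b c =
  vec3 (cos t * a - sin t * b) (sin t * a + cos t * b) c.
Proof.
apply/colP; case=> -[|[|[|]]] // ?;
by rewrite !mxE !big_ord_recl big_ord0 !mxE /=; ring.
Qed.

Lemma dot_rotz t x y : dot (rotz t *m x) (rotz t *m y) = dot x y.
Proof.
have [a [b [c ->]]] := vec3_ex x; have [a' [b' [c' ->]]] := vec3_ex y.
rewrite !rotz_vec3 !dot_vec3; ring: (cos2sin2 t).
Qed.

Lemma cross_rotz t x y :
  cross (rotz t *m x) (rotz t *m y) = rotz t *m cross x y.
Proof.
have [a [b [c ->]]] := vec3_ex x; have [a' [b' [c' ->]]] := vec3_ex y.
rewrite (cross_vec3 a) !rotz_vec3 cross_vec3; congr vec3; ring: (cos2sin2 t).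
Qed.

Lemma enorm_rotz t x : enorm (rotz t *m x) = enorm x.
Proof. by rewrite /enorm dot_rotz. Qed.

Lemma normalize_rotz t x : normalize (rotz t *m x) = rotz t *m normalize x.
Proof. by rewrite /normalize enorm_rotz scalemxAr. Qed.

Lemma rotz_trK t : (rotz t)^T *m rotz t = 1%:M.
Proof.
apply/matrixP => -[[|[|[|]]]] // ? [[|[|[|]]]] // ?;
by rewrite !mxE !big_ord_recl big_ord0 !mxE /=; ring: (cos2sin2 t).
Qed.

Lemma pullback_rotz t (Psi : 'M[R]_(3, 2)) :
  pullback (rotz t *m Psi) = pullback Psi.
Proof.
by rewrite /pullback trmx_mul mulmxA -(mulmxA Psi^T) rotz_trK mulmx1.
Qed.

Lemma unitmx_rotz t : rotz t \in unitmx.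
Proof. by have /mulmx1_unit[_] := rotz_trK t. Qed.

(** [adapted_basis] involves [l] only, so [get] picks the same pair for both maps; the rest follows
    because rotations preserve norms and cross products. *)
Lemma frame_of_rotz t (Psi : 'M[R]_(3, 2)) l :
  frame_of (rotz t *m Psi) l =
  let F := frame_of Psi l in
  Frame (rotz t *m frame_t F) (rotz t *m frame_w F) (rotz t *m frame_n F).
Proof.
by rewrite /frame_of /= -!mulmxA cross_rotz !normalize_rotz cross_rotz.
Qed.

Lemma frame_mx_rotz t (Psi : 'M[R]_(3, 2)) l :
  frame_mx (frame_of (rotz t *m Psi) l) = rotz t *m frame_mx (frame_of Psi l).
Proof.
rewrite frame_of_rotz /frame_mx /= -mul_mx_row.
exact: (esym (@mul_mx_row _ 3 3 1 2 _ _ _)).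
Qed.

Lemma FCP_rotz (Phi : R -> R -> 'M[R]_(3, 2)) eta varpi N rho phi phi' t :
    Phi rho phi' = rotz t *m Phi rho phi ->
    eta rho phi' = eta rho phi ->
    dform varpi rho phi' = dform varpi rho phi ->
    cos (2 * pi * N%:R * varpi rho phi') =
      cos (2 * pi * N%:R * varpi rho phi) ->
  FCP Phi eta varpi N rho phi' = rotz t *m FCP Phi eta varpi N rho phi.
Proof.
move=> PhiE etaE dE cosE; rewrite /FCP PhiE etaE dE cosE frame_of_rotz.
set l := dform _ _ _; set P := Phi rho phi.
move: (frame_of P l) => F /=.
(* Since [rotz t] is invertible, it cancels from the collinearity condition. The two sets are equal,
   so [get] returns the same [u] from both. *)
have -> : [set u : 'cV[R]_2 | (exists c : R, rotz t *m P *m u =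
      c *: (rotz t *m frame_t F)) /\ l *m u = 1%:M] =
    [set u | (exists c : R, P *m u = c *: frame_t F) /\ l *m u = 1%:M].
  apply/seteqP; split=> u [[c Pu] lu]; split=> //; exists c.
    by apply: (can_inj (mulKmx (unitmx_rotz t))); rewrite mulmxA Pu scalemxAr.
  by rewrite -mulmxA Pu scalemxAr.
set u := get _; rewrite -!mulmxA enorm_rotz.
by rewrite [RHS]mulmxDr [in RHS]mulmxA mulmxBr -!scalemxAr mulmxDr -!scalemxAr.
Qed.

(** * Limits and left multiplication by a matrix *)

Lemma continuous_mulmxl m n p (A : 'M[R]_(m.+1, n.+1)) :
  continuous (fun M : 'M[R]_(n.+1, p.+1) => A *m M).
Proof.
(* Expanding [M] in elementary matrices gives a finite sum of continuous coordinates times constant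
   matrices. *)
have -> : (fun M : 'M[R]_(n.+1, p.+1) => A *m M) =
    (fun M => \sum_i \sum_j M i j *: (A *m delta_mx i j)).
  apply/funext => M; rewrite {1}(matrix_sum_delta M) mulmx_sumr.
  apply: eq_bigr => i _; rewrite mulmx_sumr; apply: eq_bigr => j _.
  by rewrite -scalemxAr.
apply: continuous_big; first exact: add_continuous.
move=> i _; apply: continuous_big; first exact: add_continuous.
move=> j _ M; exact: (cvgZr_tmp (@coord_continuous R _ _ i j M)).
Qed.

(* A divergent sequence has the zero matrix as its [lim]. *)
Lemma lim_mulmxl m n (A : 'M[R]_m.+1) (u : nat -> 'M[R]_(m.+1, n.+1)) :
  A \in unitmx -> limn (fun k => A *m u k) = A *m limn u.
Proof.
move=> Aunit; have [u_cvg|u_dvg] := pselect (cvgn u).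
  apply: cvg_lim => //.
  exact: (cvg_comp _ _ u_cvg (@continuous_mulmxl _ _ _ A (limn u))).
have point0 : point = 0 :> 'M[R]_(m.+1, n.+1).
  by apply/matrixP => i j; rewrite !mxE.
rewrite (dvgP u_dvg) point0 mulmx0 -point0; apply: dvgP => Au_cvg.
pose l := limn (fun k => A *m u k).
(* If the products converged, multiplying them by [invmx A] would make [u] converge. *)
apply: u_dvg; apply/cvg_ex; exists (invmx A *m l).
have -> : u = (fun M => invmx A *m M) \o (fun k => A *m u k).
  by apply/funext => k /=; rewrite mulKmx.
exact: (cvg_comp _ _ Au_cvg (@continuous_mulmxl _ _ _ (invmx A) l)).
Qed.

End Rotation.

(** * Orthonormality of frames and invertibility of [F0] *)

Section FrameInvertibility.
Variable R : realType.
Implicit Types x y : 'cV[R]_3.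

Lemma dot_gt0 x : x != 0 -> 0 < dot x x.
Proof.
move=> x_neq0; have sq_ge0 i : 0 <= x i 0 * x i 0 by rewrite -expr2 sqr_ge0.
rewrite lt_neqAle sumr_ge0 // andbT eq_sym.
apply: contraNneq x_neq0 => /eqP; rewrite /dot psumr_eq0 // => /allP x0.
apply/eqP/colP => i; have /= := x0 i (mem_index_enum i).
by rewrite mxE mulf_eq0 orbb => /eqP.
Qed.

Lemma dotZ (a b : R) x y : dot (a *: x) (b *: y) = a * b * dot x y.
Proof.
by rewrite /dot mulr_sumr; apply: eq_bigr => i _; rewrite !mxE mulrACA.
Qed.

Lemma dot_normalize x : x != 0 -> dot (normalize x) (normalize x) = 1.
Proof.
move=> /dot_gt0 x_gt0; rewrite dotZ -expr2 exprVn sqr_sqrtr ?(ltW x_gt0) //.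
by rewrite mulVf ?gt_eqF.
Qed.

Lemma dotC x y : dot x y = dot y x.
Proof. by apply: eq_bigr => i _; rewrite mulrC. Qed.

Lemma dot_crossl x y : dot (cross x y) x = 0.
Proof.
have [a [b [c ->]]] := vec3_ex x; have [a' [b' [c' ->]]] := vec3_ex y.
by rewrite cross_vec3 dot_vec3; ring.
Qed.

Lemma dot_crossr x y : dot (cross x y) y = 0.
Proof.
have [a [b [c ->]]] := vec3_ex x; have [a' [b' [c' ->]]] := vec3_ex y.
by rewrite cross_vec3 dot_vec3; ring.
Qed.

(** Lagrange's identity. *)
Lemma dot_cross_cross x y :
  dot (cross x y) (cross x y) = dot x x * dot y y - dot x y ^+ 2.
Proof.
have [a [b [c ->]]] := vec3_ex x; have [a' [b' [c' ->]]] := vec3_ex y.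
by rewrite cross_vec3 !dot_vec3; ring.
Qed.

Lemma det_mx22 (A : 'M[R]_2) : \det A = A 0 0 * A 1 1 - A 0 1 * A 1 0.
Proof.
have l0 : lift 0 0 = 1 :> 'I_2 by apply/val_inj.
have l1 : lift 1 0 = 0 :> 'I_2 by apply/val_inj.
rewrite (expand_det_row _ 0) !big_ord_recl big_ord0 /cofactor !det_mx11 !mxE.
by rewrite !l0 !l1 /=; ring.
Qed.

Lemma det_row_mx22 (v w : 'cV[R]_2) :
  \det (row_mx v w : 'M[R]_2) = v 0 0 * w 1 0 - v 1 0 * w 0 0.
Proof.
have e0 i : (row_mx v w : 'M[R]_2) i 0 = v i 0.
  by rewrite -(row_mxEl v w); congr (row_mx _ _ _ _); apply/val_inj.
have e1 i : (row_mx v w : 'M[R]_2) i 1 = w i 0.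
  by rewrite -(row_mxEr v w); congr (row_mx _ _ _ _); apply/val_inj.
by rewrite det_mx22 !e0 !e1; ring.
Qed.

(** The cross product is bilinear and alternating, so a change of basis contributes its
    determinant. *)
Lemma cross_mulmx (Psi : 'M[R]_(3, 2)) (v w : 'cV[R]_2) :
  cross (Psi *m v) (Psi *m w) =
  \det (row_mx v w : 'M[R]_2) *: cross (col 0 Psi) (col 1 Psi).
Proof.
have mulE (z : 'cV[R]_2) : Psi *m z = z 0 0 *: col 0 Psi + z 1 0 *: col 1 Psi.
  apply/colP => i; rewrite !mxE !big_ord_recl big_ord0 addr0 mulrC.
  by congr (_ + _); rewrite mulrC; congr (_ * _); congr (_ _ _); apply/val_inj.
rewrite !mulE det_row_mx22.
have [a [b [c ->]]] := vec3_ex (col 0 Psi).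
have [a' [b' [c' ->]]] := vec3_ex (col 1 Psi).
have vec3D (p q r p' q' r' : R) :
    vec3 p q r + vec3 p' q' r' = vec3 (p + p') (q + q') (r + r').
  by apply/colP; case=> -[|[|[|]]] // ?; rewrite !mxE.
rewrite (cross_vec3 a) !scale_vec3 !vec3D cross_vec3.
by congr vec3; ring.
Qed.

(** Ensures that the pair picked by [get] in [frame_of] really is an adapted basis. *)
Lemma adapted_basis_ex (l : 'rV[R]_2) : l != 0 ->
  exists vw : 'cV[R]_2 * 'cV[R]_2, adapted_basis l vw.1 vw.2.
Proof.
(* The second vector is the first turned by a quarter turn: the determinant and the value of [l] on
   the first vector both equal the squared length of [l]. *)
move=> l0; exists (l^T, \col_i [:: - l 0 1; l 0 0]`_i) => /=.
have lift01 : lift 0 0 = 1 :> 'I_2 by apply/val_inj.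
have l_gt0 : 0 < l 0 0 ^+ 2 + l 0 1 ^+ 2.
  rewrite lt_neqAle addr_ge0 ?sqr_ge0 // andbT eq_sym.
  apply: contraNneq l0 => /eqP.
  rewrite paddr_eq0 ?sqr_ge0 // !sqrf_eq0 => /andP[/eqP l00 /eqP l01].
  apply/eqP/rowP; case=> -[|[|]] // ?; rewrite mxE.
    by rewrite -[RHS]l00; congr (l _ _); apply/val_inj.
  by rewrite -[RHS]l01; congr (l _ _); apply/val_inj.
split.
- rewrite det_row_mx22 !mxE /=; lra.
- by rewrite !mxE !big_ord_recl big_ord0 !mxE lift01 addr0 -!expr2.
- by apply/rowP => j; rewrite !mxE !big_ord_recl big_ord0 !mxE lift01 /=; ring.
Qed.

(** The frame is orthonormal, so the transpose of its matrix is an inverse. Injectivity of [Psi] is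
    expressed by the nonzero cross product of its columns. *)
Lemma frame_mx_unit (Psi : 'M[R]_(3, 2)) (l : 'rV[R]_2) :
    l != 0 -> cross (col 0 Psi) (col 1 Psi) != 0 ->
  frame_mx (frame_of Psi l) \in unitmx.
Proof.
move=> l0 Psi_inj; have /getPex := adapted_basis_ex l0.
rewrite /frame_of; set vw := get _; case=> det_gt0 _ _.
set x := Psi *m vw.1; set y := Psi *m vw.2.
have xy0 : cross x y != 0.
  by rewrite cross_mulmx scaler_eq0 negb_or gt_eqF.
(* By Lagrange's identity, [y = 0] would make [cross x y] a vector of zero length. *)
have y0 : y != 0.
  apply: contraTneq (dot_gt0 xy0) => y0.
  have dot0 z : dot z 0 = 0 by rewrite /dot big1 // => i _; rewrite mxE mulr0.
  by rewrite dot_cross_cross y0 !dot0 mulr0 expr0n subr0 ltxx.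
set w := normalize y; set n := normalize (cross x y).
have ww : dot w w = 1 by exact: dot_normalize.
have nn : dot n n = 1 by exact: dot_normalize.
have wn : dot w n = 0 by rewrite dotC dotZ dot_crossr mulr0.
have tt : dot (cross w n) (cross w n) = 1.
  by rewrite dot_cross_cross ww nn wn expr0n subr0 mulr1.
have trE z z' : z^T *m z' = (dot z z')%:M.
  rewrite [LHS]mx11_scalar mxE; congr _%:M.
  by apply: eq_bigr => i _; rewrite mxE.
suff : (row_mx (cross w n) (row_mx w n))^T *m row_mx (cross w n) (row_mx w n) =
    1%:M by case/mulmx1_unit.
rewrite !tr_row_mx !mul_col_row !mul_col_mx !mul_mx_row.
rewrite !trE ww nn (dotC n w) wn tt (dotC w (cross w n)) (dotC n (cross w n)).
by rewrite dot_crossl dot_crossr !raddf0 row_mx0 col_mx0 -!scalar_mx_block.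
Qed.

End FrameInvertibility.

(** * Equivariance of the construction under the angular shift *)

Section Equivariance.
Variable R : realType.
Implicit Types (rho phi t : R) (N : nat -> direction -> nat).

Lemma derive1_val (f : R -> R) (x d : R) : is_derive x 1 f d -> derive1 f x = d.
Proof. by move=> fd; rewrite derive1E derive_val. Qed.

(** The forms are constant in the polar basis, hence the same at [phi] and at its shift. *)
Lemma dform_varpi i rho phi : dform (varpi i) rho phi =
  \row_j (match i with
          | Dir1 => [:: -1; 0]
          | Dir2 => [:: 1; - slope R]
          | Dir3 => [:: 1; slope R]
          end)`_j.
Proof.
apply/rowP; case=> -[|[|]] // ?; rewrite !mxE /=; case: i;
  by apply: derive1_val; apply: is_derive_eq;
     rewrite ?scaler0 /GRing.scale /=; ring.
Qed.

Lemma dmap_f0 rho phi : dmap (@f0 R) rho phi =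
  \matrix_(i, j) (nth [::]
    [:: [:: 2 * cos phi; - (2 * rho * sin phi)];
        [:: 2 * sin phi; 2 * rho * cos phi];
        [:: 2 * Num.sqrt 2 * rho; 0]] i)`_j.
Proof.
have deriv_ext (f g : R -> R) (x d : R) :
    f =1 g -> derive1 g x = d -> derive1 f x = d.
  by move=> /funext ->.
apply/matrixP; case=> -[|[|[|]]] // ?; case=> -[|[|]] // ?; rewrite !mxE /=;
  (apply: deriv_ext; first by move=> y; rewrite !mxE /=; reflexivity);
  by apply: derive1_val; apply: is_derive_eq;
     rewrite ?scaler0 /GRing.scale /=; field.
Qed.

Lemma dmap_f0_rotz rho phi t :
  dmap (@f0 R) rho (phi + t) = rotz t *m dmap (@f0 R) rho phi.
Proof.
rewrite !dmap_f0.
apply/matrixP; case=> -[|[|[|]]] // ?; case=> -[|[|]] // ?;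
by rewrite !mxE !big_ord_recl big_ord0 !mxE /= ?cosD ?sinD; ring.
Qed.

Lemma F0_unit rho phi : 0 < rho -> F0 rho phi \in unitmx.
Proof.
move=> rho_gt0; apply: frame_mx_unit.
  rewrite dform_varpi; apply/eqP => /rowP /(_ 0) /eqP.
  by rewrite !mxE /= oppr_eq0 oner_eq0.
have -> : col 0 (dmap (@f0 R) rho phi) =
    vec3 (2 * cos phi) (2 * sin phi) (2 * Num.sqrt 2 * rho).
  by rewrite dmap_f0; apply/colP; case=> -[|[|[|]]] // ?; rewrite !mxE.
have -> : col 1 (dmap (@f0 R) rho phi) =
    vec3 (- (2 * rho * sin phi)) (2 * rho * cos phi) 0.
  by rewrite dmap_f0; apply/colP; case=> -[|[|[|]]] // ?; rewrite !mxE.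
(* The vertical coordinate of the cross product is [4 * rho], which is nonzero. *)
rewrite cross_vec3; apply/eqP => /colP /(_ 2) /eqP; rewrite !mxE /=.
have -> : 2 * cos phi * (2 * rho * cos phi) -
    2 * sin phi * - (2 * rho * sin phi) = 4 * rho.
  by ring: (cos2sin2 phi).
by rewrite mulf_eq0 pnatr_eq0 (gt_eqF rho_gt0).
Qed.

Lemma cosDn2pi (x : R) n : cos (x + 2 * pi * n%:R) = cos x.
Proof.
by rewrite -(periodicn (@cosD2pi R) n x); congr cos; ring.
Qed.

Lemma common_divisor_gt0 N d :
  (forall (k : nat) (i : direction), (1 <= k)%N -> (0 < N k i)%N) ->
  common_divisor N d -> (0 < d)%N.
Proof.
move=> N_gt0 /(_ 1 isT)[+ _]; case: d => // /[!dvd0n].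
by rewrite gtn_eqF ?N_gt0.
Qed.

(** The content is that the set in [Omega] is inhabited: common divisors are bounded by [N 1 Dir2],
    and the largest one is a multiple of all the others. *)
Lemma common_divisor_Omega N :
  (forall (k : nat) (i : direction), (1 <= k)%N -> (0 < N k i)%N) ->
  common_divisor N (Omega N).
Proof.
move=> N_gt0; pose P d := `[< common_divisor N d >].
have exP : exists d, P d by exists 1; apply/asboolP => k _; rewrite !dvd1n.
have leP d : P d -> (d <= N 1 Dir2)%N.
  by move=> /asboolP /(_ 1 isT) [d_dvd _]; rewrite dvdn_leq ?N_gt0.
have [d /asboolP dP d_max] := ex_maxnP exP leP.
suff /getPex[] : exists d, common_divisor N d /\
    forall e, common_divisor N e -> (e %| d)%N by [].
(* The lcm of [d] and [e] is again a common divisor, so maximality forces it to equal [d]. *)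
exists d; split=> // e eP.
have lcmP : common_divisor N (lcmn d e).
  by move=> k k_gt0; have [? ?] := dP k k_gt0; have [? ?] := eP k k_gt0;
    rewrite !dvdn_lcm; split; apply/andP.
have lcm_le : (lcmn d e <= d)%N by apply: d_max; apply/asboolP.
suff -> : d = lcmn d e by exact: dvdn_lcmr.
apply/eqP; rewrite eqn_leq lcm_le dvdn_leq ?dvdn_lcml //.
exact: common_divisor_gt0 lcmP.
Qed.

Lemma Phi_seq_rotz N (d : nat) m rho phi :
    (0 < d)%N -> common_divisor N d ->
    let t := 2 * pi / (7 * d%:R) in
  Phi_seq N m rho (phi + t) = rotz t *m Phi_seq N m rho phi.
Proof.
move=> d_gt0 d_dvd t; elim: m => [|m IH]; first exact: dmap_f0_rotz.
rewrite -[Phi_seq N m.+1]/(corrugate N (m %/ 3).+1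
  (nth Dir1 [:: Dir1; Dir2; Dir3] (m %% 3)) (Phi_seq N m)).
(* Only the stage [k >= 1] and the direction matter from here on; the bound on [k] gives access to
   the divisibility. *)
move: (m %/ 3).+1 (ltn0Sn (m %/ 3)) (nth Dir1 _ _) => k k_gt0 i.
have d0 : d%:R != 0 :> R by rewrite pnatr_eq0 -lt0n.
have pi0 : pi != 0 :> R by rewrite gt_eqF ?pi_gt0.
have slopeD : slope R * (phi + t) = slope R * phi + d%:R^-1.
  by rewrite /slope /t; move: pi pi0 => p p0; field; rewrite d0.
rewrite /corrugate; apply: FCP_rotz => //.
- have gE : g k rho (phi + t) = g k rho phi.
    by rewrite /g dmap_f0_rotz pullback_rotz.
  by rewrite gE IH pullback_rotz.
- by rewrite !dform_varpi.
case: i => //=.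
(* With [N k i = q * d], the phase drops by [2 * pi * q] for [Dir2] and grows by as much for [Dir3];
   the full turns are thus added on the left here and on the right below. *)
- have [/dvdnP[q ->] _] := d_dvd k k_gt0.
  rewrite -[LHS](cosDn2pi _ q); congr cos.
  by rewrite slopeD natrM; field.
- have [_ /dvdnP[q ->]] := d_dvd k k_gt0.
  rewrite -[RHS](cosDn2pi _ q); congr cos.
  by rewrite slopeD natrM; field.
Qed.

Lemma Phi_infty_rotz N (d : nat) rho phi :
    (0 < d)%N -> common_divisor N d ->
    let t := 2 * pi / (7 * d%:R) in
  Phi_infty N rho (phi + t) = rotz t *m Phi_infty N rho phi.
Proof.
move=> d_gt0 d_dvd t; rewrite /Phi_infty -lim_mulmxl ?unitmx_rotz //.
by congr (lim (_ @ \oo)); apply/funext => m; exact: Phi_seq_rotz.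
Qed.

End Equivariance.

Theorem lemma50 (R : realType) (N : nat -> direction -> nat)
    (N_gt0 : forall (k : nat) (i : direction), (1 <= k)%N -> (0 < N k i)%N)
    (rho : R) (rho_gt0 : 0 < rho) (rho_lt1 : rho < 1) :
  periodic (fun phi : R => nu_infty N rho phi)
           (2 * pi / (7 * (Omega N)%:R)).
Proof.
move=> phi; have OmegaP := common_divisor_Omega N_gt0.
have Omega_gt0 := common_divisor_gt0 N_gt0 OmegaP.
set t := 2 * pi / _; rewrite /nu_infty.
have -> : normal_infty N rho (phi + t) = rotz t *m normal_infty N rho phi.
  by rewrite /normal_infty !dform_varpi Phi_infty_rotz // frame_of_rotz.
have F0E : F0 rho (phi + t) = rotz t *m F0 rho phi.
  by rewrite /F0 !dform_varpi dmap_f0_rotz frame_mx_rotz.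
(* Multiplying both sides by [F0 rho phi], then by the rotation, cancels both inverses, since that
   product is the shifted [F0]. *)
rewrite F0E; apply: (can_inj (mulKmx (F0_unit phi rho_gt0))).
apply: (can_inj (mulKmx (unitmx_rotz t))).
rewrite mulKVmx ?F0_unit // mulmxA -F0E mulKVmx //.
by rewrite F0_unit.
Qed.
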